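(* Let $R$ be an associative ring with identity and let $a,b\in R$. If $ab$ is generalized Drazin invertible, then $ba$ is generalized Drazin invertible and $(ba)^{gD}=b\big((ab)^{gD}\big)^2a$.
   Context: For $x\in R$, $comm(x)=\{y\in R\mid xy=yx\}$ and $comm^2(x)=\{y\in R\mid yz=zy\text{ for all }z\in comm(x)\}$. $U(R)$ is the group of units of $R$, and $R^{qnil}=\{x\in R\mid 1+xy\in U(R)\text{ for every }y\in comm(x)\}$ is the set of quasinilpotent elements. An element $x\in R$ is generalized Drazin invertible if there is $y\in R$ with $xy^2=y$, $y\in comm^2(x)$ and $x^2y-x\in R^{qnil}$. Such a $y$ is unique if it exists; it is called the generalized Drazin inverse of $x$ and denoted $x^{gD}$. *)

(* Defs.v *)
From mathcomp Require Import all_boot all_algebra.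
From mathcomp Require Import boolp classical_sets.

Set Implicit Arguments.
Unset Strict Implicit.
Unset Printing Implicit Defensive.

Import GRing.Theory.
Local Open Scope classical_set_scope.
Local Open Scope ring_scope.

(* Rings are [pzRingType]: associative and unital, not assumed commutative,
   and possibly zero.  Two-sided invertibility is a [Prop] because
   [unitRingType] would add a decidable unit predicate and exclude 0 = 1. *)
Definition units (R : pzRingType) : set R :=
  [set u | exists v : R, u * v = 1 /\ v * u = 1].

Definition comm1 (R : pzRingType) (x : R) : set R := [set y | x * y = y * x].

Definition comm2 (R : pzRingType) (x : R) : set R :=
  [set y | forall z : R, comm1 x z -> y * z = z * y].

Definition qnil (R : pzRingType) : set R :=
  [set x | forall y : R, comm1 x y -> units (1 + x * y)].

Definition is_gDrazin_inverse (R : pzRingType) (x y : R) : Prop :=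
  [/\ x * y ^+ 2 = y, comm2 x y & qnil (x ^+ 2 * y - x)].

Definition gDrazin_invertible (R : pzRingType) (x : R) : Prop :=
  exists y : R, is_gDrazin_inverse x y.

(* The generalized Drazin inverse is unique when it exists, so the choice made
   by [xget] is immaterial; the value is 0 when x is not invertible in this
   sense. *)
Definition gDrazin (R : pzRingType) (x : R) : R :=
  xget 0 [set y | is_gDrazin_inverse x y].

(* Main.v *)
Require Import Defs.
From mathcomp Require Import all_boot all_algebra.
From mathcomp Require Import boolp classical_sets.

Import GRing.Theory.
Local Open Scope ring_scope.

(** Write [x = ab], [y] for its generalized Drazin inverse, [f = xy - 1] and
    [e = b y^2 a].  The element [(ba)^2 e - ba] equals [w = bfa].  If [z] commutes
    with [w], then [1 - (wz)^2 = (1 + wz)(1 - wz)], so it suffices to invert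
    [1 - w z^2 w].  By Jacobson's lemma this amounts to inverting
    [1 - f a z^2 b f a b = 1 + q s], where [q = x^2 y - x = f x] and
    [s = f a z^2 b f] commutes with [q]; this is possible as [q] is
    quasinilpotent. *)

Section GeneralizedDrazin.
Set Implicit Arguments.
Unset Strict Implicit.
Context {R : pzRingType}.
Implicit Types a b c d f g x y z : R.

Lemma unit_Jacobson a b : units (1 - a * b) -> units (1 - b * a).
Proof.
case=> v [uv vu]; exists (1 + b * v * a); split.
  have -> : (1 - b * a) * (1 + b * v * a)
      = 1 - b * a + b * ((1 - a * b) * v) * a.
    by rewrite mulrDr mulr1 !mulrBl mulrBr !mul1r mulrBl !mulrA.
  by rewrite uv mulr1 subrK.
have -> : (1 + b * v * a) * (1 - b * a)
    = 1 - b * a + b * (v * (1 - a * b)) * a.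
  by rewrite mulrDl mul1r !mulrBr mulr1 mulrBl !mulr1 !mulrA.
by rewrite vu mulr1 subrK.
Qed.

(** For [v] the inverse of [c * d], [d * v] is a right inverse of [c] and, as [c] and [d] commute,
    [v * d] is a left inverse; hence the two coincide. *)
Lemma unit_comm_factor c d : c * d = d * c -> units (c * d) -> units c.
Proof.
move=> cd [v [uv vu]].
have vdc : v * d * c = 1 by rewrite -mulrA -cd.
have cdv : c * (d * v) = 1 by rewrite mulrA.
exists (d * v); split => //.
by rewrite -[d * v]mul1r -vdc -[_ * (d * v)]mulrA cdv mulr1.
Qed.

Lemma idempotent_unit_compl g : g * g = g -> units (1 - g) -> g = 0.
Proof.
move=> gg [v [_ vu]].
by rewrite -[g]mul1r -vu -mulrA mulrBl mul1r gg subrr mulr0.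
Qed.

Lemma gDrazin_comm x y : is_gDrazin_inverse x y -> GRing.comm y x.
Proof. by case=> _ yx _; apply: yx. Qed.

Lemma gDrazin_idempotent x y :
  is_gDrazin_inverse x y -> (x * y) ^+ 2 = x * y.
Proof.
move=> Hy; have xy := gDrazin_comm Hy; case: Hy => Ey _ _.
by rewrite expr2 -mulrA [y * _]mulrA xy -mulrA -expr2 Ey.
Qed.

(** With [e = xy] and [e' = xy'], the element [e (1 - e')] is an idempotent whose complement is
    [1 + (x^2 y' - x) y], a unit because [x^2 y' - x] is quasinilpotent and commutes with [y]; so
    the idempotent vanishes. *)
Lemma gDrazin_idempotent_absorb x y y' :
  is_gDrazin_inverse x y -> is_gDrazin_inverse x y' ->
  x * y = x * y * (x * y').
Proof.
move=> Hy Hy'; have yx := gDrazin_comm Hy; have y'x := gDrazin_comm Hy'.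
have ee := gDrazin_idempotent Hy; have ee' := gDrazin_idempotent Hy'.
case: Hy Hy' => [_ Cy _] [_ _ Q'].
have yy' : GRing.comm y y' by apply: Cy.
have ye' : GRing.comm y (x * y') by apply: commrM.
have xe' : GRing.comm x (x * y') by apply/commrM/commr_sym.
have Cee' : GRing.comm (x * y) (1 - x * y').
  apply: commrB; first exact: commr1.
  by apply/commr_sym/commrM; exact/commr_sym.
have ee'' : (1 - x * y') ^+ 2 = 1 - x * y'.
  by rewrite expr2 mulrBl mul1r mulrBr mulr1 -expr2 ee' subrr subr0.
apply/eqP; rewrite -subr_eq0 -{1}[x * y]mulr1 -mulrBr.
apply/eqP/idempotent_unit_compl; first by rewrite -expr2 exprMn_comm // ee ee''.
have -> : 1 - x * y * (1 - x * y') = 1 + (x ^+ 2 * y' - x) * y.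
  have -> : x ^+ 2 * y' - x = - (x * (1 - x * y')).
    by rewrite mulrBr mulr1 opprB expr2 mulrA.
  have y1e' : y * (1 - x * y') = (1 - x * y') * y.
    by apply: commrB => //; exact: commr1.
  by rewrite mulNr -!mulrA y1e'.
apply: Q'; rewrite /comm1 /=; apply/commr_sym/commrB => //.
by apply/commrM => //; apply: commrX.
Qed.

(** By absorption in both directions the commuting idempotents [xy] and [xy'] coincide; then
    [y = xyy = xy'y = xyy' = xy'y' = y']. *)
Lemma gDrazin_unique x y y' :
  is_gDrazin_inverse x y -> is_gDrazin_inverse x y' -> y = y'.
Proof.
move=> Hy Hy'; have yx := gDrazin_comm Hy; have y'x := gDrazin_comm Hy'.
have e1 := gDrazin_idempotent_absorb Hy Hy'.
have e2 := gDrazin_idempotent_absorb Hy' Hy.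
case: Hy Hy' => [Ey Cy _] [Ey' Cy' _].
have yy' : GRing.comm y y' by apply: Cy.
have ee : x * y = x * y'.
  rewrite e1 [RHS]e2; apply: commrM; apply/commr_sym; apply: commrM => //;
    exact: commr_sym.
by rewrite -Ey -Ey' !expr2 !mulrA ee -mulrA -yy' mulrA ee.
Qed.

Lemma gDrazinE x y : is_gDrazin_inverse x y -> gDrazin x = y.
Proof.
by move=> Hy; apply: (@gDrazin_unique x) => //; apply: (xgetPex 0 (ex_intro _ y Hy)).
Qed.

Lemma qnil_flank a b f :
  f * f = - f -> f * (a * b) = a * b * f ->
  qnil (f * (a * b)) -> qnil (b * f * a).
Proof.
move=> ff fx Q z; rewrite /comm1 /=; set w := b * f * a => wz.
pose s := f * a * z ^+ 2 * b * f.
have wz2 : w * z ^+ 2 = z ^+ 2 * w by apply: commrX.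
(* The products of [s] and [f * (a * b)] in either order sandwich [w z^2 = z^2 w] between [f a] and
   [b f], so these elements commute. *)
have qs : f * (a * b) * s = f * a * (w * z ^+ 2) * b * f by rewrite /s /w !mulrA.
have sq : s * (f * (a * b)) = f * a * (z ^+ 2 * w) * b * f.
  by rewrite fx /s /w -!mulrA.
have Us : units (1 + s * (f * (a * b))).
  by rewrite sq -wz2 -qs; apply: Q; rewrite /comm1 /= qs sq wz2.
apply: (@unit_comm_factor _ (1 - w * z)).
  apply: commrB; first exact: commr1.
  by apply/commr_sym/commrD => //; exact: commr1.
have -> : (1 + w * z) * (1 - w * z) = 1 - b * (f * a * z ^+ 2 * b * f * a).
  have -> : b * (f * a * z ^+ 2 * b * f * a) = w * z * (w * z).
    by rewrite {2}wz -!mulrA [z * (z * w)]mulrA -expr2 /w !mulrA.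
  by rewrite mulrDl mul1r mulrBr mulr1 addrA subrK.
apply: unit_Jacobson.
(* Replacing the inner [f] by [- f * f] splits off [s] and yields the sign required by [Us]. *)
suff -> : f * a * z ^+ 2 * b * f * a * b = - (s * (f * (a * b))) by rewrite opprK.
by rewrite /s -!mulrA [f * (f * _)]mulrA ff mulNr !mulrN opprK.
Qed.

Lemma gDrazin_Cline a b y :
  is_gDrazin_inverse (a * b) y -> is_gDrazin_inverse (b * a) (b * y ^+ 2 * a).
Proof.
move=> Hy; have yx := gDrazin_comm Hy; have ee := gDrazin_idempotent Hy.
case: Hy => Ey Cy Q; split.
- have -> : b * a * (b * y ^+ 2 * a) ^+ 2
      = b * (a * b * y ^+ 2) * (a * b * y ^+ 2) * a by rewrite expr2 !mulrA.
  by rewrite Ey expr2 !mulrA.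
- move=> z; rewrite /comm1 /= => bz.
  (* As [z] commutes with [ba], the element [t = azb] commutes with [ab], hence with [y]. *)
  have xt : a * b * (a * z * b) = a * z * b * (a * b).
    by rewrite -!mulrA [b * (a * (z * b))]mulrA [b * a * _]mulrA bz !mulrA.
  have yt : GRing.comm (a * z * b) y by apply/commr_sym/Cy.
  (* Writing [y^2] as [x y^3 = y^3 x] creates a factor [ba] next to [z]; moving it past [z] makes
     [t] appear, and both [b y^2 a z] and [z b y^2 a] become [b y^3 t a]. *)
  have xy3 : a * b * y ^+ 3 = y ^+ 2.
    by rewrite [y ^+ 3]exprSr mulrA Ey expr2.
  have y3x : y ^+ 3 * (a * b) = y ^+ 2.
    by rewrite -[RHS]xy3; apply/commr_sym/commrX/commr_sym.
  have ty : a * z * b * y ^+ 3 = y ^+ 3 * (a * z * b) by apply: commrX.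
  transitivity (b * (y ^+ 3 * (a * z * b)) * a).
    by rewrite -y3x -!mulrA [b * (a * z)]mulrA bz !mulrA.
  by rewrite -ty -[in RHS]xy3 !mulrA bz !mulrA.
- have -> : (b * a) ^+ 2 * (b * y ^+ 2 * a) - b * a = b * (a * b * y - 1) * a.
    rewrite mulrBr mulr1 mulrBl; congr (_ - _).
    by rewrite -[in RHS]Ey expr2 !mulrA.
  apply: qnil_flank.
  (* Here [- f = 1 - xy] is the idempotent complementary to [xy]. *)
  + by rewrite -expr2 sqrrB1 ee mulr2n opprD addrA subrr add0r opprB addrC.
  + apply: commr_sym; apply: commrB; last exact: commr1.
    by apply: commrM => //; exact: commr_sym.
  + suff -> : (a * b * y - 1) * (a * b) = (a * b) ^+ 2 * y - a * b by [].
    by rewrite mulrBl mul1r -mulrA yx expr2 mulrA.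
Qed.
End GeneralizedDrazin.

Theorem theorem2p8 (R : pzRingType) (a b : R) :
  gDrazin_invertible (a * b) ->
  gDrazin_invertible (b * a) /\
  gDrazin (b * a) = b * gDrazin (a * b) ^+ 2 * a.
Proof.
case=> y Hy; rewrite (gDrazinE Hy).
have He := gDrazin_Cline Hy.
by split; [exists (b * y ^+ 2 * a) | exact: gDrazinE].
Qed.
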